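(* Let $q$ be a power of a prime $p$. Let $d$ be a positive integer such that $d\mid(q-1)$ and $p\nmid d$, and let $H\le\mathbb F_q^\times$ be a multiplicative subgroup of order $d$. Then $H\in\mathcal B_{W_d^{\mathrm{Luc}}}$. If, in addition, $p\nmid(d+1)$, then $H\cup\{\infty\}\in\mathcal B_{W_{d+1}^{\mathrm{Luc}}}$.
   Context: For nonnegative integers $i,k$ with base-$p$ expansions $i=\sum_r i_rp^r$, $k=\sum_r k_rp^r$ ($0\le i_r,k_r\le p-1$), write $i\le_p k$ if $i_r\le k_r$ for all $r$. $\mathbb F_q[X,Y]_k$ is the space of homogeneous polynomials of degree $k$ over $\mathbb F_q$. The Lucas subspace is $W_k^{\mathrm{Luc}}=\mathrm{span}_{\mathbb F_q}\{X^{k-i}Y^i:0\le i\le k,\ i\le_p k\}\subseteq\mathbb F_q[X,Y]_k$. $\mathbb P^1(\mathbb F_q)=\mathbb F_q\cup\{\infty\}$. For a $k$-subset $S\subseteq\mathbb P^1(\mathbb F_q)$, $F_S(X,Y)=\prod_{t\in S}(X-tY)$, where the factor for $t=\infty$ is taken to be $Y$. For a subspace $W\subseteq\mathbb F_q[X,Y]_k$, $\mathcal B_W=\{S\subseteq\mathbb P^1(\mathbb F_q): |S|=k,\ F_S\in W\}$. *)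

(* Defs.v *)
From mathcomp Require Import all_boot all_order all_algebra all_fingroup all_field.
From mathcomp Require Export mpoly.

Set Implicit Arguments.
Unset Strict Implicit.
Unset Printing Implicit Defensive.

Import GRing.Theory.
Local Open Scope ring_scope.

Definition digit (p n r : nat) : nat := ((n %/ p ^ r) %% p)%N.

(* Only the ranks r <= i are tested: p ^ r > i for r > i, so the other digits
   of i vanish (see lucas_leP). *)
Definition lucas_le (p i k : nat) : bool :=
  [forall r : 'I_i.+1, (digit p i r <= digit p k r)%N].

Lemma lucas_leP p i k : (1 < p)%N ->
  reflect (forall r : nat, (digit p i r <= digit p k r)%N) (lucas_le p i k).
Proof.
move=> p_gt1; apply: (iffP forallP) => [le_ik r | le_ik r]; last exact: le_ik.
have [r_le_i | i_lt_r] := ltnP r i.+1; first exact: (le_ik (Ordinal r_le_i)).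
rewrite /digit divn_small ?mod0n //.
exact: leq_trans i_lt_r (ltnW (ltn_expl r p_gt1)).
Qed.

Section LucasSubspace.

Variable F : finFieldType.

Notation X := ('X_0 : {mpoly F[2]}).
Notation Y := ('X_1 : {mpoly F[2]}).

Lemma var_homog (j : 'I_2) : ('X_j : {mpoly F[2]}) \is 1.-homog.
Proof. by rewrite dhomogX; apply/eqP; apply: mdeg1. Qed.

Lemma monomial_homog k (i : 'I_k.+1) : X ^+ (k - i) * Y ^+ i \is k.-homog.
Proof.
have hX := dhomogMn (k - i) (var_homog 0); have hY := dhomogMn i (var_homog 1).
by have := dhomogM hX hY; rewrite !mul1n subnK // -ltnS.
Qed.

Definition monomial k (i : 'I_k.+1) : dhomog 2 F k := DHomog (monomial_homog i).

Definition lucas_subspace (p k : nat) : {vspace dhomog 2 F k} :=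
  <<[seq monomial i | i : 'I_k.+1 <- enum 'I_k.+1 & lucas_le p i k]>>%VS.

(* The projective line over F; None is the point at infinity. *)
Definition P1 := option F.

Definition point_form (t : P1) : {mpoly F[2]} :=
  if t is Some a then X - a *: Y else Y.

Definition set_form (S : {set P1}) : {mpoly F[2]} := \prod_(t in S) point_form t.

Lemma set_form_homog (S : {set P1}) : set_form S \is #|S|.-homog.
Proof.
have hpt t : point_form t \is 1.-homog.
  case: t => [a|] /=; last exact: var_homog.
  by rewrite rpredB ?rpredZ ?var_homog.
rewrite -sum1_card /set_form.
elim/big_ind2: _ => [|d P e Q hP hQ|t _]; [exact: dhomog1 | exact: dhomogM | exact: hpt].
Qed.

(* indhomog k sends a polynomial that is not k-homogeneous to 0; this cannot occur
   here, since #|S| = k (see basis_familyP). *)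
Definition basis_family k (W : {vspace dhomog 2 F k}) : {set {set P1}} :=
  [set S : {set P1} | (#|S| == k) && (indhomog k (set_form S) \in W)].

Lemma basis_familyP k (W : {vspace dhomog 2 F k}) (S : {set P1}) :
  S \in basis_family W <->
  #|S| = k /\ exists2 w : dhomog 2 F k, w \in W & set_form S = w :> {mpoly F[2]}.
Proof.
rewrite inE; split=> [/andP[/eqP Sk inW] | [Sk [w inW def_w]]].
  split=> //; exists (indhomog k (set_form S)) => //.
  by rewrite /indhomog insubdK // -Sk; apply: set_form_homog.
rewrite Sk eqxx /=; suff -> : indhomog k (set_form S) = w by [].
by rewrite def_w; apply: valKd.
Qed.

Definition units_in_P1 (H : {set {unit F}}) : {set P1} :=
  [set Some (FinRing.uval u) | u in H].

End LucasSubspace.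

(* Main.v *)
Require Import Defs.
From mathcomp Require Import all_boot all_order all_algebra all_fingroup all_field.
From mathcomp Require Import cyclic fraction.

(** By Lagrange the elements of [H] are the [d] roots of [T^d - 1]; homogenizing
    gives [F_H = X^d - Y^d], whose exponents [i = 0] and [i = d] satisfy
    [i <=_p d] for trivial reasons.  Adjoining infinity multiplies by [Y], giving
    [X^d Y - Y^(d+1)]; here [1 <=_p d + 1] says that the last digit of [d + 1]
    is nonzero, i.e. that [p] does not divide [d + 1]. *)

Import GRing.Theory.

Lemma lucas_le0 p k : lucas_le p 0 k.
Proof. by apply/forallP => r; rewrite /digit div0n mod0n. Qed.

Lemma lucas_le_refl p k : lucas_le p k k.
Proof. by apply/forallP => r. Qed.

(** All digits of $1$ at positive ranks vanish, so only the rank $0$ imposes a condition. *)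
Lemma lucas_le1 p k : (1 < p)%N -> lucas_le p 1 k = ~~ (p %| k)%N.
Proof.
move=> p_gt1; rewrite /dvdn -lt0n.
apply/lucas_leP/idP => // [/(_ 0)|k0_gt0 [|r]].
- by rewrite /digit expn0 !divn1 modn_small.
- by rewrite /digit expn0 !divn1 modn_small.
by rewrite {1}/digit divn_small ?mod0n // -(exp1n r.+1) ltn_exp2r.
Qed.

Section UnitSubgroup.

Local Open Scope ring_scope.

Variables (F : finFieldType) (H : {group {unit F}}).

Lemma prod_XsubC_unit_group :
  \prod_(u in H) ('X - (FinRing.uval u)%:P) = 'X^#|H| - 1 :> {poly F}.
Proof.
pose rs := [seq FinRing.uval u | u <- enum H].
have size_rs : size rs = #|H| by rewrite size_map -cardE.
have def_p : 'X^#|H| - 1 = lead_coef ('X^#|H| - 1) *: \prod_(z <- rs) ('X - z%:P)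
             :> {poly F}.
  apply: all_roots_prod_XsubC.
  - by rewrite size_rs -polyC1 size_XnsubC ?cardG_gt0.
  - apply/allP => _ /mapP[u Hu ->]; rewrite mem_enum in Hu.
    rewrite rootE !hornerE subr_eq0 -FinRing.val_unitX.
    by rewrite expg_cardG // FinRing.val_unit1.
  rewrite uniq_rootsE map_inj_uniq ?enum_uniq //; exact: val_inj.
rewrite def_p (monicP _) ?scale1r ?big_map ?big_enum //.
exact/monic_Xn_sub_1/cardG_gt0.
Qed.

(** Homogenization: evaluate the one-variable identity at [x / y] and clear denominators. The
    division is why [K] is a field and [y] is nonzero. *)
Lemma prod_sub_unit_group (K : fieldType) (f : {rmorphism F -> K}) (x y : K) :
  y != 0 ->
  \prod_(u in H) (x - f (FinRing.uval u) * y) = x ^+ #|H| - y ^+ #|H|.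
Proof.
move=> y0.
have /(congr1 (fun r => (map_poly f r).[x / y] * y ^+ #|H|)) := prod_XsubC_unit_group.
(* The power of [y] is spread over the product, one [y] for each factor. *)
rewrite rmorph_prod horner_prod -prodr_const -big_split /=.
rewrite prodr_const rmorphB rmorph1 /= map_polyXn !hornerE mulrBl mul1r -exprMn divfK // => <-.
apply: eq_bigr => u _.
by rewrite map_polyXsubC !hornerE mulrBl divfK.
Qed.

(** Polynomials embed in their fraction field, where dividing by ['X_1] is legitimate; injectivity
    of [tofrac] brings the identity back. *)
Lemma set_form_units :
  set_form (units_in_P1 H) = 'X_0 ^+ #|H| - 'X_1 ^+ #|H|.
Proof.
rewrite /set_form big_imset /=; last by move=> u v _ _ [] /val_inj.
apply/eqP; rewrite -tofrac_eq; apply/eqP.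
rewrite rmorph_prod rmorphB !rmorphXn /=.
have Y0 : FracField.tofrac ('X_1 : {mpoly F[2]}) != 0.
  rewrite tofrac_eq0; apply/eqP => /(congr1 (mcoeff U_(1))).
  by rewrite mcoeffX eqxx mcoeff0 => /eqP; rewrite oner_eq0.
rewrite -(prod_sub_unit_group _ (@FracField.tofrac {mpoly F[2]} \o @mpolyC 2 F)) //.
by apply: eq_bigr => u _; rewrite rmorphB /= -mul_mpolyC rmorphM.
Qed.

Lemma card_units_in_P1 : #|units_in_P1 H| = #|H|.
Proof. by rewrite card_imset // => u v [] /val_inj. Qed.

Lemma infty_notin_units : None \notin units_in_P1 H.
Proof. by apply/imsetP => -[]. Qed.

End UnitSubgroup.

Lemma monomial_lucas (F : finFieldType) p k (i : 'I_k.+1) :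
  lucas_le p i k -> monomial F i \in lucas_subspace F p k.
Proof. by move=> le_ik; apply/memv_span/map_f; rewrite mem_filter le_ik mem_enum. Qed.

Theorem proposition9 (F : finFieldType) (p m q d : nat) (H : {group {unit F}})
    (p_prime : prime p) (m_gt0 : 0 < m) (q_def : q = p ^ m) (cardF : #|F| = q)
    (d_gt0 : 0 < d) (d_dvd : d %| q - 1) (p_ndvd_d : ~~ (p %| d))
    (cardH : #|H| = d) :
  units_in_P1 H \in basis_family (lucas_subspace F p d) /\
  (~~ (p %| d.+1) ->
   None |: units_in_P1 H \in basis_family (lucas_subspace F p d.+1)).
Proof.
have formH := set_form_units F H; rewrite cardH in formH.
split=> [|p_ndvd_d1]; apply/basis_familyP; split.
- by rewrite card_units_in_P1.
- exists (monomial F (ord0 : 'I_d.+1) - monomial F (ord_max : 'I_d.+1))%R.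
    by rewrite rpredB ?monomial_lucas ?lucas_le0 ?lucas_le_refl.
  by rewrite formH /= subn0 subnn !expr0 mulr1 mul1r.
- by rewrite cardsU1 infty_notin_units card_units_in_P1 cardH.
(* [i1] is the exponent of $Y$ in $X^d Y$; its membership is where [p_ndvd_d1] enters, through
   [lucas_le1]. *)
pose i1 : 'I_d.+2 := Ordinal (isT : (1 < d.+2)%N).
exists (monomial F i1 - monomial F (ord_max : 'I_d.+2))%R.
  by rewrite rpredB ?monomial_lucas ?lucas_le_refl ?lucas_le1 ?prime_gt1.
rewrite /set_form big_setU1 ?infty_notin_units //= -/(set_form _) formH.
by rewrite subn1 subnn expr0 mul1r expr1 mulrBr -exprS mulrC.
Qed.
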